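(* Let $K\ge 1$ be an integer and let $\alpha>0$, $b>0$, $\sigma>0$, $\sigma_0>0$ be real numbers. Let $L:\mathbb{R}^K\to\mathbb{R}$ be the quadratic loss $L(W)=\frac12 W^{T}AW$ with $A\in\mathbb{R}^{K\times K}$ symmetric positive definite. Let $p_{\mathrm{ss}}$ be the (quasi-)steady-state probability density on $\mathbb{R}^K$ given by $$p_{\mathrm{ss}}(W)=C_{1,\mathrm{loc}}\,e^{-\frac{2bL(W)}{\alpha\sigma^2}},$$ where $C_{1,\mathrm{loc}}>0$ is the normalizing constant, and let $p_0$ be the Gaussian initialization density $$p_0(W)=\frac{1}{(2\pi\sigma_0^2)^{K/2}}\,e^{-\frac{\|W\|^2}{2\sigma_0^2}}.$$ Write $\mathbb{E}_{\mathrm{ss}}$ for expectation with respect to $p_{\mathrm{ss}}$ and $\bar L(W)=L(W)/K$. Then $$\mathbb{E}_{\mathrm{ss}}[\bar L(W)]\le \frac{\alpha\sigma^2}{2bK}\left[\frac K2\log(2\pi\sigma_0^2)+\log(C_{1,\mathrm{loc}})+\frac{\mathbb{E}_{\mathrm{ss}}[\|W\|^2]}{2\sigma_0^2}\right].$$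
   Context: Interpretation: $W\in\mathbb{R}^K$ is the parameter vector of a model trained by stochastic gradient descent with learning rate $\alpha$ and minibatch size $b$, with gradient-noise covariance $\Sigma=\sigma^2 I$. In the continuous-time approximation the dynamics are $dW^{(t)}=-\nabla L\,dt+\sqrt{\alpha/b}\,\sigma\,dV_t$ with $V_t$ a Wiener process; $p_{\mathrm{ss}}$ is the stationary solution of the associated Fokker-Planck equation near a deep local minimum (placed at $W=0$), where the loss is assumed to be quadratic. The initial parameter satisfies $W^{(0)}\sim p_0$. $\|\cdot\|$ is the Euclidean norm and $\log$ the natural logarithm. $\bar L$ is the loss averaged over (divided by) the number $K$ of parameters. *)

(* Defs.v *)
From HB Require Import structures.
From mathcomp Require Import all_boot all_order all_algebra.
From mathcomp Require Import all_classical all_reals all_analysis.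
Set Implicit Arguments.
Unset Strict Implicit.
Unset Printing Implicit Defensive.
Import Order.TTheory GRing.Theory Num.Theory.
Import numFieldNormedType.Exports.
Local Open Scope classical_set_scope.
Local Open Scope ring_scope.
Local Open Scope ereal_scope.

(* R^n is represented by [n.-tuple R], which carries the product of the Borel
   sigma-algebras.  [measurableTypeR R] and [R] have the same measurable sets
   (but different displays); [lebesgue_measure] lives on the former. *)

Section lebesgue_step.
Context {R : realType} {n : nat}.

Definition tcons (p : measurableTypeR R * n.-tuple R) : n.+1.-tuple R :=
  [the n.+1.-tuple R of p.1 :: p.2].

Definition tuncons (t : n.+1.-tuple R) : measurableTypeR R * n.-tuple R :=
  (tnth t ord0, [tuple of behead t]).

Lemma tconsK : cancel tcons tuncons.
Proof.
by case=> x t; rewrite /tcons /tuncons; congr pair; apply/val_inj.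
Qed.

Lemma tunconsK : cancel tuncons tcons.
Proof. by move=> t; rewrite [RHS]tuple_eta; apply/val_inj. Qed.

Lemma measurable_tcons : measurable_fun setT tcons.
Proof. exact: measurable_cons. Qed.

Lemma measurable_tuncons : measurable_fun setT tuncons.
Proof.
by apply/measurable_fun_pair;
  [exact: measurable_tnth|exact: measurable_behead].
Qed.

HB.instance Definition _ :=
  isMeasurableFun.Build _ _ _ _ tcons measurable_tcons.

Variable mu : {sigma_finite_measure set (n.-tuple R) -> \bar R}.

Definition lebesgue_step : set (n.+1.-tuple R) -> \bar R :=
  pushforward (@lebesgue_measure R \x mu) tcons.

Let lebesgue_step0 : lebesgue_step set0 = 0. Proof. exact: measure0. Qed.

Let lebesgue_step_ge0 A : 0 <= lebesgue_step A. Proof. exact: measure_ge0. Qed.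

Let lebesgue_step_sigma_additive : semi_sigma_additive lebesgue_step.
Proof. exact: measure_semi_sigma_additive. Qed.

HB.instance Definition _ := isMeasure.Build _ _ _ lebesgue_step
  lebesgue_step0 lebesgue_step_ge0 lebesgue_step_sigma_additive.

Let lebesgue_step_sigma_finite : sigma_finite setT lebesgue_step.
Proof.
have /sigma_finiteP[F [TF ndF Foo]] := sigma_finiteT (@lebesgue_measure R).
have /sigma_finiteP[G [TG ndG Goo]] := sigma_finiteT mu.
exists (fun k => tuncons @^-1` (F k `*` G k)).
  rewrite -preimage_bigcup -[LHS](preimage_setT tuncons); congr (_ @^-1` _).
  apply/seteqP; split=> // -[x t] _.
  have [i _ Fx] : (\bigcup_i F i) x by rewrite -TF.
  have [j _ Gt] : (\bigcup_j G j) t by rewrite -TG.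
  exists (maxn i j) => //; split => /=.
    by move: x Fx; exact/subsetPset/ndF/leq_maxl.
  by move: t Gt; exact/subsetPset/ndG/leq_maxr.
move=> k; have [mF Fk] := Foo k; have [mG Gk] := Goo k; split.
  rewrite -[X in measurable X]setTI; apply: measurable_tuncons => //.
  exact: measurableX.
rewrite /lebesgue_step /pushforward -comp_preimage.
rewrite (_ : tuncons \o tcons = id); last exact/funext/tconsK.
by rewrite preimage_id product_measure1E// lte_mul_pinfty// ge0_fin_numE.
Qed.

HB.instance Definition _ :=
  Measure_isSigmaFinite.Build _ _ _ lebesgue_step lebesgue_step_sigma_finite.

End lebesgue_step.

(* Lebesgue measure on R^n, by transporting the product of the one-dimensional
   and the (n-1)-dimensional Lebesgue measures along R * R^(n-1) ~ R^n; it is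
   the unique measure satisfying [lebesgue_tuple_box]. *)
Fixpoint lebesgue_tuple (R : realType) (n : nat) :
    {sigma_finite_measure set (n.-tuple R) -> \bar R} :=
  match n with
  | 0 => \d_([tuple] : 0.-tuple R)
  | m.+1 => lebesgue_step (lebesgue_tuple R m)
  end.

Lemma lebesgue_tuple_box (R : realType) (n : nat) (B : 'I_n -> set R) :
  (forall i, measurable (B i)) ->
  lebesgue_tuple R n [set W | forall i, B i (tnth W i)] =
    \prod_(i < n) lebesgue_measure (B i).
Proof.
elim: n B => [|n IHn] B mB.
  rewrite big_ord0 /= diracE mem_set//= => -[] //.
have mbox :
    measurable [set W : n.-tuple R | forall i, B (lift ord0 i) (tnth W i)].
  rewrite (_ : mkset _ = \big[setI/setT]_(i < n)
      ((fun W : n.-tuple R => tnth W i) @^-1` B (lift ord0 i))).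
    apply: bigsetI_measurable => i _; rewrite -[X in measurable X]setTI.
    exact: measurable_tnth.
  apply/seteqP; split=> W /=.
    move=> BW; rewrite -bigcap_seq => i _ /=; exact: BW.
  rewrite -bigcap_seq => BW i; apply: BW; exact: mem_index_enum.
rewrite big_ord_recl -IHn; last by move=> i; exact: mB.
rewrite -product_measure1E//=; last exact: (mB ord0).
rewrite /lebesgue_step /pushforward; congr (_ _).
apply/seteqP; split=> -[x t] /=.
  move=> BW; split; first exact: (BW ord0).
  by move=> i; have := BW (lift ord0 i); rewrite tnthS.
move=> [Bx Bt] i; case: (unliftP ord0 i) => [j ->|->//].
by rewrite tnthS.
Qed.

Definition has_density (R : realType) (n : nat)
    (P : probability (n.-tuple R) R) (p : n.-tuple R -> R) : Prop :=
  forall E, measurable E -> P E = \int[lebesgue_tuple R n]_(W in E) (p W)%:E.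

Local Close Scope ereal_scope.

Definition colvec (R : realType) (n : nat) (W : n.-tuple R) : 'cV[R]_n :=
  \col_i tnth W i.

(* The library norm on matrices is the sup norm, so the Euclidean norm is
   defined here. *)
Definition enorm (R : realType) (n : nat) (W : n.-tuple R) : R :=
  Num.sqrt (\sum_(i < n) tnth W i ^+ 2).

Definition sym_posdef (R : realType) (n : nat) (A : 'M[R]_n) : Prop :=
  A^T = A /\ forall x : 'cV[R]_n, x != 0 -> 0 < (x^T *m A *m x) 0 0.

(* Main.v *)
(** The claim is the nonnegativity of the Kullback-Leibler divergence of
    [p_ss] from [p_0].  Since [1 + ln (p_0 / p_ss) <= p_0 / p_ss] pointwise and
    [E_ss[p_0 / p_ss] = \int p_0 = 1], integrating against [P_ss] gives
    [E_ss[2 b L / (alpha sigma^2)] <= ln C1loc + K/2 ln (2 pi sigma0^2)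
    + E_ss[|W|^2] / (2 sigma0^2)].  All expectations are taken of nonnegative
    functions, so no integrability has to be established. *)

Require Import Defs.
From mathcomp Require Import all_boot all_order all_algebra.
From mathcomp Require Import all_classical all_reals all_analysis.
From mathcomp Require Import measurable_realfun ring lra.
Import Order.TTheory GRing.Theory Num.Theory.
Import numFieldNormedType.Exports.
Local Open Scope ring_scope.

(** * Integration against a measure given by a density *)

Section density.
Context d (T : measurableType d) (R : realType).
Variables (mu : {sigma_finite_measure set T -> \bar R})
  (P : {finite_measure set T -> \bar R}) (p : T -> R).
Hypothesis mp : measurable_fun setT p.
Hypothesis Pp : forall E, measurable E -> P E = (\int[mu]_(x in E) (p x)%:E)%E.
Local Open Scope ereal_scope.

(** A [mu]-null set has zero [p]-integral, so [P] is absolutely continuous with respect to [mu]. Its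
    Radon-Nikodym derivative and [p] have the same integral over every measurable set, hence agree
    almost everywhere. *)
Lemma ge0_integral_density (f : T -> \bar R) : (forall x, 0 <= f x) ->
  measurable_fun setT f -> \int[P]_x f x = \int[mu]_x (f x * (p x)%:E).
Proof.
move=> f_ge0 mf.
have mpE : measurable_fun setT (EFin \o p) by exact/measurable_EFinP.
have Pmu : P `<< mu.
  apply/null_content_dominatesP => A mA A0; rewrite Pp//.
  by apply: null_set_integral => //; exact: measurable_funTS.
rewrite -(Radon_Nikodym_SigmaFinite.change_of_variables Pmu)//.
have mRN := Radon_Nikodym_SigmaFinite.f_integrable Pmu.
apply: ae_eq_integral => //.
- by apply: emeasurable_funM => //; exact: measurable_int mRN.
- exact: emeasurable_funM.
apply: ae_eqe_mul2l; apply: integral_ae_eq => // E _ mE.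
by rewrite -Pp// (Radon_Nikodym_SigmaFinite.f_integral Pmu).
Qed.

End density.

(** * Gibbs' inequality for densities in exponential form *)

Section gibbs.
Context d (T : measurableType d) (R : realType).
Variables (mu : {sigma_finite_measure set T -> \bar R}) (P : probability T R).
Local Open Scope ereal_scope.

(** The log-densities are [k - f] and [l - g], so nonnegative divergence becomes a comparison of the
    means of [f] and [g], meaningful even when these are infinite. The second density only needs
    mass at most 1. *)
Lemma gibbs_expR (f g : T -> R) (k l : R) :
  measurable_fun setT f -> measurable_fun setT g ->
  (forall x, 0 <= f x)%R -> (forall x, 0 <= g x)%R ->
  (forall E, measurable E -> P E = \int[mu]_(x in E) (expR (k - f x))%:E) ->
  \int[mu]_x (expR (l - g x))%:E <= 1 ->
  \int[P]_x (f x)%:E <= (k - l)%:E + \int[P]_x (g x)%:E.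
Proof.
move=> mf mg f_ge0 g_ge0 Pp q_le1.
have mfE := (measurable_EFinP _ _).2 mf; have mgE := (measurable_EFinP _ _).2 mg.
(* [r] is the ratio of the second density to that of [P]; its [P]-mean is the mass of the second
   density. *)
pose r x := expR (l - g x - (k - f x)).
have mr : measurable_fun setT r.
  apply: measurableT_comp => //; apply: measurable_funB.
    exact: measurable_funB.
  exact: measurable_funB.
have mrE := (measurable_EFinP _ _).2 mr.
have intr : \int[P]_x (r x)%:E <= 1.
  rewrite (@ge0_integral_density _ _ _ mu P (fun x => expR (k - f x)))//.
  - under eq_integral => x _ do rewrite -EFinM -expRD subrK.
    exact: q_le1.
  - by apply: measurableT_comp => //; exact: measurable_funB.
  - by move=> x; rewrite lee_fin expR_ge0.
have c1_ge0 : (0 <= 1 + `|k - l|)%R by rewrite addr_ge0.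
have c2_ge0 : (0 <= k - l + `|k - l|)%R.
  by rewrite -lerBlDl sub0r -normrN ler_norm.
have intc (c : R) : \int[P]_x c%:E = c%:E.
  by rewrite integral_cst//= probability_setT mule1.
(* The constants are split between the two sides so that both integrands are
   nonnegative, which makes integration additive even if E[f] or E[g] is
   infinite. *)
have : \int[P]_x ((f x)%:E + (1 + `|k - l|)%:E) <=
       \int[P]_x ((r x)%:E + ((g x)%:E + (k - l + `|k - l|)%:E)).
  apply: ge0_le_integral => //.
  - by move=> x _; rewrite -EFinD lee_fin addr_ge0.
  - exact: emeasurable_funD.
  - by apply: emeasurable_funD => //; exact: emeasurable_funD.
  - move=> x _; rewrite -!EFinD lee_fin.
    have := expR_ge1Dx (l - g x - (k - f x)); rewrite -/(r x); lra.
rewrite !ge0_integralD//; last 5 first.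
- by move=> x _; rewrite lee_fin.
- by move=> x _; rewrite lee_fin expR_ge0.
- by move=> x _; rewrite -EFinD lee_fin addr_ge0.
- exact: emeasurable_funD.
- by move=> x _; rewrite lee_fin.
rewrite !intc.
have f0 : 0 <= \int[P]_x (f x)%:E by apply: integral_ge0 => x _; rewrite lee_fin.
have g0 : 0 <= \int[P]_x (g x)%:E by apply: integral_ge0 => x _; rewrite lee_fin.
have r0 : 0 <= \int[P]_x (r x)%:E.
  by apply: integral_ge0 => x _; rewrite lee_fin expR_ge0.
(* Cancelling the added constants requires finite values. If the mean of [g] is infinite the bound
   is trivial; otherwise the mean of [r], at most 1, keeps the right side finite and so excludes an
   infinite mean of [f]. *)
move: f0 g0 r0 intr.
case: (\int[P]_x (g x)%:E) => [y| |]; last by rewrite leeNy_eq.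
  case: (\int[P]_x (r x)%:E) => [z| |]; last by rewrite leeNy_eq.
    case: (\int[P]_x (f x)%:E) => [x| |]; last by rewrite leeNy_eq.
      by rewrite -!EFinD !lee_fin => _ _ _ ? ?; lra.
    by rewrite addye.
  by rewrite leye_eq.
by move=> *; rewrite addey ?leey.
Qed.

End gibbs.

(** * Product integrals over R^n and the Gaussian mass *)

Section lebesgue_tuple_prod.
Context (R : realType).
Local Open Scope ereal_scope.

(** The measure is a pushforward along [tcons] of a product measure: change variables, then apply
    Tonelli. *)
Lemma integral_lebesgue_tupleS n (f : n.+1.-tuple R -> \bar R) :
  measurable_fun setT f -> (forall W, 0 <= f W) ->
  \int[lebesgue_tuple R n.+1]_W f W =
  \int[lebesgue_measure]_x \int[lebesgue_tuple R n]_t f (tcons (x, t)).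
Proof.
move=> mf f_ge0.
have mft : measurable_fun setT (f \o @tcons R n).
  exact: (measurableT_comp mf (@measurable_tcons R n)).
transitivity (\int[lebesgue_measure \x lebesgue_tuple R n]_z (f \o @tcons R n) z).
  exact: (@ge0_integral_pushforward _ _ _ _ _ _ (@measurable_tcons R n)
    (lebesgue_measure \x lebesgue_tuple R n)%E setT f measurableT mf).
by rewrite fubini_tonelli1//= => z; exact: f_ge0.
Qed.

Lemma integral_lebesgue_tuple_prod n (h : R -> R) :
  measurable_fun setT h -> (forall x, 0 <= h x)%R ->
  \int[lebesgue_tuple R n]_W (\prod_(i < n) h (tnth W i))%:E =
  (\int[lebesgue_measure]_x (h x)%:E) ^+ n.
Proof.
move=> mh h_ge0; elim: n => [|n IHn].
  (* In dimension 0 the measure is a Dirac mass and the empty product integrates to 1. *)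
  under eq_integral do rewrite big_ord0.
  by rewrite integral_cst//= diracT mule1.
have mprod m : measurable_fun setT
    (fun W : m.-tuple R => (\prod_(i < m) h (tnth W i))%:E).
  apply/measurable_EFinP; apply: measurable_prod => i _.
  by apply: measurableT_comp => //; exact: measurable_tnth.
have prod_ge0 m (W : m.-tuple R) : 0 <= (\prod_(i < m) h (tnth W i))%:E.
  by rewrite lee_fin prodr_ge0.
rewrite integral_lebesgue_tupleS//.
have inner x : \int[lebesgue_tuple R n]_t
      (\prod_(i < n.+1) h (tnth (tcons (x, t)) i))%:E =
    (h x)%:E * (\int[lebesgue_measure]_x (h x)%:E) ^+ n.
  rewrite -IHn -ge0_integralZl//=; last 3 first.
  - exact: mprod.
  - by move=> t _; exact: prod_ge0.
  - by rewrite lee_fin.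
  apply: eq_integral => t _; rewrite big_ord_recl /= EFinM.
  by under eq_bigr do rewrite tnthS.
under eq_integral do rewrite inner.
rewrite expeS ge0_integralZr//=.
- exact/measurable_EFinP.
- by move=> x _; rewrite lee_fin.
- by apply: expe_ge0; apply: integral_ge0 => x _; rewrite lee_fin.
Qed.

End lebesgue_tuple_prod.

(** The integrand is the product over the coordinates of centred normal densities of standard
    deviation [s], each of mass 1. *)
Lemma integral_gaussian_density (R : realType) (n : nat) (s : R) : 0 < s ->
  (\int[lebesgue_tuple R n]_W
    (expR (- (n%:R / 2 * ln (2 * pi * s ^+ 2)) -
           (2 * s ^+ 2)^-1 * enorm W ^+ 2))%:E = 1)%E.
Proof.
move=> s_gt0; have s_neq0 : s != 0 by rewrite gt_eqF.
have c_gt0 : 0 < 2 * pi * s ^+ 2 by rewrite !mulr_gt0// ?pi_gt0 ?exprn_gt0.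
rewrite -[RHS]/(1%:E) -[in RHS](expr1n R n) EFin_expe -(integral_normal_pdf 0 s).
rewrite -integral_lebesgue_tuple_prod; last 2 first.
- exact: measurable_normal_pdf.
- by move=> x; exact: normal_pdf_ge0.
apply: eq_integral => W _; congr EFin.
under eq_bigr do rewrite normal_pdfE//.
rewrite big_split/= prodr_const card_ord -expR_sum expRD; congr (_ * _).
  have -> : normal_peak s = (Num.sqrt (2 * pi * s ^+ 2))^-1.
    by rewrite /normal_peak; congr (Num.sqrt _)^-1; ring.
  rewrite exprVn -powR12_sqrt ?ltW// /powR gt_eqF// -expRM_natl.
  by rewrite -expRN; congr expR; ring.
congr expR; rewrite sqr_sqrtr ?sumr_ge0//; last by move=> i _; exact: sqr_ge0.
rewrite mulr_sumr -sumrN; apply: eq_bigr => i _.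
by rewrite subr0 mulNr -[s ^+ 2 *+ 2]mulr_natl [_^-1 * _]mulrC.
Qed.

(** * Measurability and sign of the quadratic functions *)

Lemma measurable_enorm_sqr (R : realType) (n : nat) :
  measurable_fun setT (fun W : n.-tuple R => enorm W ^+ 2).
Proof.
rewrite (_ : (fun _ => _) = fun W : n.-tuple R => \sum_(i < n) tnth W i ^+ 2).
  apply: measurable_sum => i; apply: measurable_funX; exact: measurable_tnth.
by apply/funext => W; rewrite sqr_sqrtr// sumr_ge0// => i _; exact: sqr_ge0.
Qed.

Lemma measurable_quadratic_form (R : realType) (n : nat) (A : 'M[R]_n) :
  measurable_fun setT
    (fun W : n.-tuple R => ((colvec W)^T *m A *m colvec W) 0 0).
Proof.
rewrite (_ : (fun _ => _) = fun W : n.-tuple R =>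
    \sum_(j < n) (\sum_(i < n) tnth W i * A i j) * tnth W j).
  apply: measurable_sum => j; apply: measurable_funM; last exact: measurable_tnth.
  apply: measurable_sum => i; apply: measurable_funM => //.
  exact: measurable_tnth.
apply/funext => W; rewrite mxE; apply: eq_bigr => j _; rewrite !mxE.
by congr (_ * _); apply: eq_bigr => i _; rewrite !mxE.
Qed.

Lemma sym_posdef_ge0 (R : realType) (n : nat) (A : 'M[R]_n) (x : 'cV[R]_n) :
  sym_posdef A -> 0 <= (x^T *m A *m x) 0 0.
Proof.
by move=> [_ Ap]; have [->|/Ap/ltW//] := eqVneq x 0; rewrite mulmx0 mxE.
Qed.

(** * Application to the steady state and the Gaussian initialization *)

Theorem mainTheorem1 (R : realType) (K : nat)
  (alpha b sigma sigma0 : R) (A : 'M[R]_K)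
  (L Lbar p_ss p_0 : K.-tuple R -> R) (C1loc : R)
  (P_ss : probability (K.-tuple R) R)
  (K_ge1 : (1 <= K)%N)
  (alpha_gt0 : 0 < alpha) (b_gt0 : 0 < b)
  (sigma_gt0 : 0 < sigma) (sigma0_gt0 : 0 < sigma0)
  (A_posdef : sym_posdef A)
  (LE : forall W, L W = 2^-1 * ((colvec W)^T *m A *m colvec W) 0 0)
  (LbarE : forall W, Lbar W = L W / K%:R)
  (C1loc_gt0 : 0 < C1loc)
  (p_ssE : forall W,
    p_ss W = C1loc * expR (- (2 * b * L W / (alpha * sigma ^+ 2))))
  (P_ss_density : has_density P_ss p_ss)
  (p_0E : forall W,
    p_0 W = ((2 * pi * sigma0 ^+ 2) `^ (K%:R / 2))^-1 *
            expR (- (enorm W ^+ 2 / (2 * sigma0 ^+ 2)))) :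
  ('E_P_ss[Lbar] <=
   (alpha * sigma ^+ 2 / (2 * b * K%:R))%:E *
   ((K%:R / 2 * ln (2 * pi * sigma0 ^+ 2))%:E + (ln C1loc)%:E
    + ((2 * sigma0 ^+ 2)^-1)%:E * 'E_P_ss[(fun W => enorm W ^+ 2)%R]))%E.
Proof.
(* [c] is the temperature of the Gibbs density [p_ss], which is proportional to
   [expR (- (L W / c))]. *)
pose c := alpha * sigma ^+ 2 / (2 * b).
have c_gt0 : 0 < c by rewrite divr_gt0// !mulr_gt0// exprn_gt0.
have K_gt0 : 0 < K%:R :> R by rewrite ltr0n.
have s_ge0 : 0 <= (2 * sigma0 ^+ 2)^-1 by rewrite invr_ge0 mulr_ge0 ?sqr_ge0.
have L_ge0 W : 0 <= L W by rewrite LE mulr_ge0 ?invr_ge0// sym_posdef_ge0.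
have mL : measurable_fun setT L.
  rewrite (_ : L = fun W => 2^-1 * ((colvec W)^T *m A *m colvec W) 0 0).
    by apply: measurable_funM => //; exact: measurable_quadratic_form.
  exact/funext.
have mN := measurable_enorm_sqr R K.
pose f W := c^-1 * L W; pose g (W : K.-tuple R) := (2 * sigma0 ^+ 2)^-1 * enorm W ^+ 2.
have p_ssfE W : p_ss W = expR (ln C1loc - f W).
  rewrite p_ssE expRD lnK ?posrE//; congr (_ * expR (- _)).
  by rewrite /f /c invf_div; field; rewrite !gt_eqF.
have Ef : ('E_P_ss[Lbar] = (c / K%:R)%:E * \int[P_ss]_W (f W)%:E)%E.
  rewrite unlock -ge0_integralZl//; last 3 first.
  - by apply/measurable_EFinP; exact: measurable_funM.
  - by move=> W _; rewrite lee_fin mulr_ge0// invr_ge0 ltW.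
  - by rewrite lee_fin divr_ge0// ltW.
  apply: eq_integral => W _; rewrite -EFinM LbarE /f; congr EFin.
  by field; rewrite !gt_eqF.
have Eg : (((2 * sigma0 ^+ 2)^-1)%:E * 'E_P_ss[(fun W => enorm W ^+ 2)%R] =
           \int[P_ss]_W (g W)%:E)%E.
  rewrite unlock -ge0_integralZl//.
  - exact/measurable_EFinP.
  - by move=> W _; rewrite lee_fin sqr_ge0.
have -> : alpha * sigma ^+ 2 / (2 * b * K%:R) = c / K%:R.
  by rewrite /c; field; rewrite !gt_eqF.
have cK_gt0 : 0 < c / K%:R by rewrite divr_gt0.
rewrite Ef Eg lee_pmul2l ?lte_fin// -EFinD.
(* [- l] is the logarithm of the Gaussian normalizing factor, so [expR (- l - g W)] is the
   initialization density; this is the form that [gibbs_expR] expects. *)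
set l := K%:R / 2 * _; have -> : l + ln C1loc = ln C1loc - - l.
  by rewrite opprK addrC.
apply: (@gibbs_expR _ _ _ (lebesgue_tuple R K)).
- exact: measurable_funM.
- exact: measurable_funM.
- by move=> W; rewrite mulr_ge0// invr_ge0 ltW.
- by move=> W; rewrite mulr_ge0// sqr_ge0.
- by move=> E mE; rewrite P_ss_density//; under eq_integral do rewrite p_ssfE.
- by rewrite integral_gaussian_density.
Qed.
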